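(* Let $(M^6, g, J)$ be a compact $6$-dimensional strict nearly Kähler manifold. Then $M$ admits no non-trivial (i.e. not identically zero) $J$-anti-invariant $\ast$-Killing $2$-form.
   Context: An almost Hermitian manifold $(M,g,J)$ is a Riemannian manifold $(M,g)$ with an almost complex structure $J$ compatible with $g$, i.e. $g(JX,JY)=g(X,Y)$. Its fundamental $2$-form is $\omega(X,Y)=g(JX,Y)$. Let $\nabla$ be the Levi-Civita connection of $g$. The manifold $(M,g,J)$ is nearly Kähler if $X\lrcorner\nabla_X\omega=0$ for every tangent vector $X$; it is called strict if $\nabla_X J\neq 0$ for every tangent vector $X\neq 0$. A $2$-form $\sigma$ is $J$-anti-invariant if $\sigma(JX,JY)=-\sigma(X,Y)$ for all tangent vectors $X,Y$, i.e. $\sigma$ is of type $(2,0)+(0,2)$. A $p$-form $\sigma$ on a Riemannian manifold $(M^n,g)$ is a conformal Killing $p$-form if for every tangent vector $X$ $$\nabla_X\sigma=\tfrac{1}{p+1}\,X\lrcorner d\sigma-\tfrac{1}{n-p+1}\,X\wedge d^*\sigma ,$$ where $d^*$ is the formal adjoint of $d$ and tangent and cotangent vectors are identified via $g$. A $\ast$-Killing $p$-form is a conformal Killing $p$-form $\sigma$ with $d\sigma=0$. *)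

(* Defs.v *)
(* Smooth manifolds are given by a smooth atlas, and tensor fields by their
   local expressions in all the charts, related by the usual transformation
   laws.  A tangent vector at a point of the domain of a chart is represented
   by the row vector of its components in this chart, and a p-form at a point
   by an alternating p-linear map on families 'I_p -> 'rV[R]_n. *)
From HB Require Import structures.
From mathcomp Require Import all_boot all_order all_algebra.
From mathcomp Require Import all_classical all_reals all_analysis.

Set Implicit Arguments.
Unset Strict Implicit.
Unset Printing Implicit Defensive.

Import Order.TTheory GRing.Theory Num.Theory.
Import numFieldNormedType.Exports.

Local Open Scope classical_set_scope.
Local Open Scope ring_scope.

Section Smooth.
Context {R : realType} {V W : normedModType R}.

Definition iter_derive (s : seq V) (f : V -> W) : V -> W :=
  foldr (fun v h x => 'D_v h x) f s.

Definition smooth_on (U : set V) (f : V -> W) : Prop :=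
  forall (s : seq V) (x : V), U x -> differentiable (iter_derive s f) x.

End Smooth.

Record chart (R : realType) (n : nat) (M : topologicalType) := Chart {
  chart_dom : set M;
  chart_fun : M -> 'rV[R]_n;
  chart_inv : 'rV[R]_n -> M;
  chart_dom_open : open chart_dom;
  chart_img_open : open (chart_fun @` chart_dom);
  chart_funK : forall p, chart_dom p -> chart_inv (chart_fun p) = p;
  chart_fun_continuous : {within chart_dom, continuous chart_fun};
  chart_inv_continuous :
    {within chart_fun @` chart_dom, continuous chart_inv} }.

Definition chart_img (R : realType) (n : nat) (M : topologicalType)
  (c : chart R n M) : set 'rV[R]_n := chart_fun c @` chart_dom c.

Definition overlap (R : realType) (n : nat) (M : topologicalType)
  (c d : chart R n M) : set 'rV[R]_n :=
  chart_fun c @` (chart_dom c `&` chart_dom d).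

Definition transition (R : realType) (n : nat) (M : topologicalType)
  (c d : chart R n M) : 'rV[R]_n -> 'rV[R]_n := chart_fun d \o chart_inv c.

Record manifold (R : realType) (n : nat) := Manifold {
  carrier :> topologicalType;
  manifold_hausdorff : hausdorff_space carrier;
  manifold_second_countable : @second_countable carrier;
  chart_index : Type;
  atlas : chart_index -> chart R n carrier;
  atlas_cover : forall p : carrier, exists i, chart_dom (atlas i) p;
  atlas_smooth : forall i j,
    smooth_on (overlap (atlas i) (atlas j)) (transition (atlas i) (atlas j)) }.

(* Multilinear algebra and differential operators on an open set of R^n. *)
Section Local.
Context {R : realType} {n : nat}.
Local Notation V := 'rV[R]_n.

Definition basis_vec (k : 'I_n) : V := delta_mx 0 k.

Definition gprod (G : 'M[R]_n) (u v : V) : R := (u *m G *m v^T) 0 0.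

Definition vcons (p : nat) (X : V) (Y : 'I_p -> V) : 'I_p.+1 -> V :=
  fun a => if unlift ord0 a is Some b then Y b else X.

Definition is_multilinear (p : nat) (w : ('I_p -> V) -> R) : Prop :=
  forall (Y : 'I_p -> V) (a : 'I_p) (c : R) (u v : V),
    w [eta Y with a |-> c *: u + v] =
    c * w [eta Y with a |-> u] + w [eta Y with a |-> v].

Definition is_alternating (p : nat) (w : ('I_p -> V) -> R) : Prop :=
  forall (Y : 'I_p -> V) (a b : 'I_p), a != b -> Y a = Y b -> w Y = 0.

Definition interior_product (p : nat) (X : V) (w : ('I_p.+1 -> V) -> R) :
    ('I_p -> V) -> R := fun Y => w (vcons X Y).

(* the wedge product of the covector dual to X with w *)
Definition wedge_vec (p : nat) (G : 'M[R]_n) (X : V) (w : ('I_p -> V) -> R) :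
    ('I_p.+1 -> V) -> R :=
  fun Y => \sum_(a < p.+1) (-1) ^+ a * gprod G X (Y a) * w (Y \o lift a).

(* The inner product of p-forms induced by G, for which the wedge products
   e_i1 /\ ... /\ e_ip, i1 < ... < ip, of an orthonormal basis are
   orthonormal; the sum runs over all multi-indices, whence the 1 / p!. *)
Definition form_inner (p : nat) (G : 'M[R]_n) (w1 w2 : ('I_p -> V) -> R) : R :=
  (p`!%:R)^-1 *
  \sum_(s : {ffun 'I_p -> 'I_n}) \sum_(t : {ffun 'I_p -> 'I_n})
    (\prod_(a < p) invmx G (s a) (t a)) *
    w1 (basis_vec \o s) * w2 (basis_vec \o t).

Definition local_form (p : nat) := V -> ('I_p -> V) -> R.

Definition smooth_form (p : nat) (U : set V) (w : local_form p) : Prop :=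
  [/\ forall x, U x -> is_multilinear (w x),
      forall x, U x -> is_alternating (w x)
    & forall Y, smooth_on U (fun x => w x Y)].

Definition ext_d (p : nat) (w : local_form p) : local_form p.+1 :=
  fun x Y => \sum_(a < p.+1) (-1) ^+ a * 'D_(Y a) (fun z => w z (Y \o lift a)) x.

(* The Koszul formula for constant vector fields u, v, w, which commute. *)
Definition koszul (g : V -> 'M[R]_n) (x u v w : V) : R :=
  2^-1 * ('D_u (fun z => gprod (g z) v w) x + 'D_v (fun z => gprod (g z) u w) x
          - 'D_w (fun z => gprod (g z) u v) x).

(* The Levi-Civita connection: nabla_u v at x for constant vector fields u, v,
   i.e. the vector whose g-product with any w is koszul g x u v w. *)
Definition christoffel (g : V -> 'M[R]_n) (x u v : V) : V :=
  (\row_k koszul g x u v (basis_vec k)) *m invmx (g x).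

Definition nabla_form (p : nat) (g : V -> 'M[R]_n) (X : V) (w : local_form p) :
    local_form p :=
  fun x Y => 'D_X (fun z => w z Y) x
    - \sum_(a < p) w x [eta Y with a |-> christoffel g x X (Y a)].

(* (nabla_X J) Y; endomorphisms act on row vectors on the right *)
Definition nabla_endo (g J : V -> 'M[R]_n) (X : V) (x Y : V) : V :=
  'D_X (fun z => Y *m J z) x + christoffel g x X (Y *m J x)
  - christoffel g x X Y *m J x.

End Local.

(* The Lebesgue integral over R^n, as an iterated integral; it is only applied
   to continuous functions with compact support. *)
Fixpoint integral_Rn (R : realType) (n : nat) : ('rV[R]_n -> R) -> R :=
  match n with
  | 0%N => fun f => f 0
  | m.+1 => fun f =>
      \int[@lebesgue_measure R]_(t in [set: R])
        integral_Rn (fun v : 'rV[R]_m => f (row_mx (t%:M : 'rV[R]_1) v))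
  end.

Section Manifold.
Context {R : realType} {n : nat} (M : manifold R n).
Local Notation V := 'rV[R]_n.

Definition img (i : chart_index M) : set V := chart_img (atlas i).
Definition ovl (i j : chart_index M) : set V := overlap (atlas i) (atlas j).
Definition trans (i j : chart_index M) : V -> V := transition (atlas i) (atlas j).

Record riem_metric := RiemMetric {
  riem_at :> chart_index M -> V -> 'M[R]_n;
  riem_smooth : forall i u v,
    smooth_on (img i) (fun x => gprod (riem_at i x) u v);
  riem_sym : forall i x u v, img i x ->
    gprod (riem_at i x) u v = gprod (riem_at i x) v u;
  riem_pos : forall i x u, img i x -> u != 0 ->
    0 < gprod (riem_at i x) u u;
  riem_glue : forall i j x u v, ovl i j x ->
    gprod (riem_at i x) u v =
    gprod (riem_at j (trans i j x)) ('D_u (trans i j) x) ('D_v (trans i j) x)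
}.

Record almost_complex := AlmostComplex {
  acs_at :> chart_index M -> V -> 'M[R]_n;
  acs_smooth : forall i (u : V), smooth_on (img i) (fun x => u *m acs_at i x);
  acs_sqr : forall i x, img i x -> acs_at i x *m acs_at i x = - 1%:M;
  acs_glue : forall i j x (u : V), ovl i j x ->
    'D_(u *m acs_at i x) (trans i j) x =
    'D_u (trans i j) x *m acs_at j (trans i j x)
}.

Record pform (p : nat) := PForm {
  pform_at :> chart_index M -> local_form p;
  pform_smooth : forall i, smooth_form (img i) (pform_at i);
  pform_glue : forall i j x Y, ovl i j x ->
    pform_at i x Y = pform_at j (trans i j x) (fun a => 'D_(Y a) (trans i j) x)
}.

(* tau = d^* sigma, d^* being the formal adjoint of d for the L^2 products;
   the test forms with compact support in the domain of a chart suffice, by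
   partitions of unity. *)
Definition is_codifferential (g : riem_metric) (p : nat)
    (sigma : pform p.+1) (tau : pform p) : Prop :=
  forall (i : chart_index M) (alpha : local_form p),
    smooth_form (img i) alpha ->
    (exists K : set V, [/\ compact K, K `<=` img i
                         & forall x Y, ~ K x -> alpha x Y = 0]) ->
    integral_Rn (fun x => form_inner (g i x) (ext_d alpha x) (sigma i x)
                          * Num.sqrt (\det (g i x))) =
    integral_Rn (fun x => form_inner (g i x) (alpha x) (tau i x)
                          * Num.sqrt (\det (g i x))).

Definition conformal_killing (g : riem_metric) (p : nat) (sigma : pform p.+1) :
    Prop :=
  exists2 tau : pform p, is_codifferential g sigma tau &
    forall (i : chart_index M) (x X : V) (Y : 'I_p.+1 -> V), img i x ->
      nabla_form (g i) X (sigma i) x Y =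
      (p.+1%:R + 1)^-1 * interior_product X (ext_d (sigma i) x) Y
      - (n%:R - p.+1%:R + 1)^-1 * wedge_vec (g i x) X (tau i x) Y.

Definition closed_form (p : nat) (sigma : pform p) : Prop :=
  forall (i : chart_index M) (x : V) (Y : 'I_p.+1 -> V), img i x ->
    ext_d (sigma i) x Y = 0.

Definition star_killing (g : riem_metric) (p : nat) (sigma : pform p.+1) : Prop :=
  conformal_killing g sigma /\ closed_form sigma.

Definition almost_hermitian (g : riem_metric) (J : almost_complex) : Prop :=
  forall (i : chart_index M) (x u v : V), img i x ->
    gprod (g i x) (u *m J i x) (v *m J i x) = gprod (g i x) u v.

Definition fundamental_form (g : riem_metric) (J : almost_complex)
    (i : chart_index M) : local_form 2 :=
  fun x Y => gprod (g i x) (Y ord0 *m J i x) (Y ord_max).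

Definition nearly_kahler (g : riem_metric) (J : almost_complex) : Prop :=
  forall (i : chart_index M) (x X : V) (Y : 'I_1 -> V), img i x ->
    interior_product X (nabla_form (g i) X (fundamental_form g J i) x) Y = 0.

Definition strict_nearly_kahler (g : riem_metric) (J : almost_complex) : Prop :=
  [/\ almost_hermitian g J, nearly_kahler g J
    & forall (i : chart_index M) (x X : V), img i x -> X != 0 ->
        exists Y : V, nabla_endo (g i) (J i) X x Y != 0].

Definition anti_invariant (J : almost_complex) (sigma : pform 2) : Prop :=
  forall (i : chart_index M) (x : V) (Y : 'I_2 -> V), img i x ->
    sigma i x (fun a => Y a *m J i x) = - sigma i x Y.

Definition nontrivial_form (p : nat) (sigma : pform p) : Prop :=
  exists (i : chart_index M) (x : V) (Y : 'I_p -> V),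
    img i x /\ sigma i x Y <> 0.

End Manifold.

(* Main.v *)
From HB Require Import structures.
Require Import Defs.
From mathcomp Require Import all_boot all_order all_algebra.
From mathcomp Require Import all_classical all_reals all_analysis.
From mathcomp Require Import ring lra.

(** The obstruction is algebraic and lives in a single tangent space. Let sigma
    be J-anti-invariant, closed and conformal Killing, let S be the skew
    endomorphism with g(S u, v) = sigma(u, v), and let A_X be the covariant
    derivative of J along X. The conformal Killing equation of a closed form
    says that the covariant derivative of sigma along X is the wedge product of X
    with a covector t independent of X ([star_killing_cov]). Anti-invariance is
    S J = - J S; differentiated along X it becomes an identity between the
    wedge product of X with t on one side, and S and A_X on the other
    ([cov_anti_invariant]):

      (X /\ t)(J u, v) - (X /\ t)(u, J v) = g(S u, A_X v) - g(S (A_X u), v).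

    The endomorphism A_X is skew and anticommutes with J, and the nearly Kaehler
    condition makes A_X Y alternating in X and Y. At X = u = v the right hand
    side vanishes, since A_u u = 0, while the left hand side is
    - 2 g(u, u) t(J u); hence t = 0 ([covector_part_eq0]). At u = v and arbitrary
    X the identity then says that g(S u, A_X u) = 0, that is, A_u (S u) = 0.

    So A_u kills both u and S u, and S u is orthogonal to u and to J u because S
    is skew and anticommutes with J. If S u were not zero, A_u would kill a
    complex plane of the three-dimensional complex tangent space; a skew
    endomorphism anticommuting with J has even complex rank, so A_u would be zero
    ([skew_eq0]), which strictness excludes. Hence S = 0
    ([antiinvariant_eq0]).

    The remaining work is to obtain the properties of A_X and the differentiated
    identity from the coordinate expressions: the metric, J and sigma are turned
    into matrix-valued functions on the image of a chart, and the Koszul formula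
    gives the compatibility of the connection with the metric
    ([metric_compatible]). *)

Set Implicit Arguments.
Unset Strict Implicit.
Unset Printing Implicit Defensive.

Import Order.TTheory GRing.Theory Num.Theory.
Import numFieldNormedType.Exports.

Local Open Scope classical_set_scope.
Local Open Scope ring_scope.

(** * Bilinear forms given by matrices *)

Section Gprod.
Context {R : realType} {n : nat}.
Local Notation V := 'rV[R]_n.
Implicit Types (G J : 'M[R]_n) (u v w : V).

Lemma gprodDl G u v w : gprod G (u + v) w = gprod G u w + gprod G v w.
Proof. by rewrite /gprod !mulmxDl mxE. Qed.

Lemma gprodDr G u v w : gprod G u (v + w) = gprod G u v + gprod G u w.
Proof. by rewrite /gprod linearD mulmxDr mxE. Qed.

Lemma gprod_linm c G H u v :
  gprod (c *: G + H) u v = c * gprod G u v + gprod H u v.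
Proof.
by rewrite /gprod mulmxDr mulmxDl mxE -scalemxAr -scalemxAl [in LHS]mxE.
Qed.

Lemma gprodDm G H u v : gprod (G + H) u v = gprod G u v + gprod H u v.
Proof. by rewrite -[G]scale1r gprod_linm scale1r mul1r. Qed.

Lemma gprod_invmx G (r : V) v : G \in unitmx ->
  gprod G (r *m invmx G) v = \sum_k v 0 k * r 0 k.
Proof.
move=> Gunit; rewrite /gprod mulmxKV// mxE.
by apply: eq_bigr => k _; rewrite mxE mulrC.
Qed.

Lemma gprodZl G c u v : gprod G (c *: u) v = c * gprod G u v.
Proof. by rewrite /gprod -!scalemxAl mxE. Qed.

Lemma gprodZr G c u v : gprod G u (c *: v) = c * gprod G u v.
Proof. by rewrite /gprod linearZ -scalemxAr mxE. Qed.

Lemma gprodNl G u v : gprod G (- u) v = - gprod G u v.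
Proof. by rewrite -scaleN1r gprodZl mulN1r. Qed.

Lemma gprodNr G u v : gprod G u (- v) = - gprod G u v.
Proof. by rewrite -scaleN1r gprodZr mulN1r. Qed.

Lemma gprod0l G v : gprod G 0 v = 0.
Proof. by rewrite -(scale0r 0) gprodZl mul0r. Qed.

Lemma gprod0r G u : gprod G u 0 = 0.
Proof. by rewrite -(scale0r 0) gprodZr mul0r. Qed.

Lemma alternating_skew G : (forall u, gprod G u u = 0) ->
  forall u v, gprod G u v = - gprod G v u.
Proof.
move=> diag u v.
by have := diag (u + v); rewrite !(gprodDl, gprodDr) !diag; lra.
Qed.

Lemma gprodA G u v (A : 'M[R]_n) : gprod G (u *m A) v = gprod (A *m G) u v.
Proof. by rewrite /gprod !mulmxA. Qed.

Lemma gprodAr G u v (A : 'M[R]_n) : gprod G u (v *m A) = gprod (G *m A^T) u v.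
Proof. by rewrite /gprod trmx_mul !mulmxA. Qed.

Lemma gprod_basis G i j : gprod G (basis_vec i) (basis_vec j) = G i j.
Proof. by rewrite /gprod -rowE /basis_vec trmx_delta -colE !mxE. Qed.

Lemma gprod_inj G H : (forall u v, gprod G u v = gprod H u v) -> G = H.
Proof. by move=> GH; apply/matrixP => i j; rewrite -!gprod_basis. Qed.

(** The wedge product of the dual of X with the covector u |-> u t; the covector
    is not identified with a vector, so that G need not be inverted. *)
Definition wedge_covec G X (t : 'cV[R]_n) u v : R :=
  gprod G X u * (v *m t) 0 0 - gprod G X v * (u *m t) 0 0.

End Gprod.

(** * Skew endomorphisms of a Hermitian vector space *)

Section Hermitian.
Context {R : realType} {n : nat} {G J : 'M[R]_n}.
Local Notation V := 'rV[R]_n.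
Local Notation "<< u , v >>" := (gprod G u v).
Implicit Types u v w X Y : V.
Hypothesis Gsym : forall u v, <<u, v>> = <<v, u>>.
Hypothesis Gpos : forall u, u != 0 -> 0 < <<u, u>>.
Hypothesis Jsqr : J *m J = - 1%:M.
Hypothesis Jisom : forall u v, <<u *m J, v *m J>> = <<u, v>>.

Lemma gprod_eq0 u : <<u, u>> = 0 -> u = 0.
Proof.
by move=> uu; apply/eqP/negP => /negP/Gpos; rewrite uu ltxx.
Qed.

Lemma gprod_nondeg u : (forall v, <<u, v>> = 0) -> u = 0.
Proof. by move=> /(_ u)/gprod_eq0. Qed.

Lemma metric_unit : G \in unitmx.
Proof.
rewrite -row_free_unit -kermx_eq0; apply/eqP/row_matrixP => i.
rewrite row0; apply: gprod_eq0.
by rewrite /gprod -row_mul mulmx_ker row0 mul0mx mxE.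
Qed.

Lemma mulJJ (u : V) : u *m J *m J = - u.
Proof. by rewrite -mulmxA Jsqr mulmxN mulmx1. Qed.

Lemma gprodJr u v : <<u, v *m J>> = - <<u *m J, v>>.
Proof. by rewrite -Jisom mulJJ gprodNr. Qed.

Lemma gprod_selfJ u : <<u, u *m J>> = 0.
Proof. by have := gprodJr u u; rewrite (Gsym (u *m J)); lra. Qed.

(** Stacking the vectors into a matrix B, the Gram matrix B G B^T is an
    invertible diagonal matrix that factors through R^n. *)
Lemma orthogonal_card k (v : 'I_k -> V) : (forall a, v a != 0) ->
  (forall a b, a != b -> <<v a, v b>> = 0) -> (k <= n)%N.
Proof.
move=> v0 vorth; pose B := \matrix_a v a.
have BE : B *m G *m B^T = diag_mx (\row_a <<v a, v a>>).
  apply/matrixP => a b.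
  have -> : (B *m G *m B^T) a b = <<v a, v b>>.
    rewrite /gprod !mxE; apply: eq_bigr => j _; rewrite !mxE.
    by congr (_ * _); apply: eq_bigr => l _; rewrite !mxE.
  rewrite !mxE; have [->|ab] := eqVneq a b; first by rewrite mulr1n.
  by rewrite vorth.
have : B *m G *m B^T \in unitmx.
  rewrite BE unitmxE det_diag unitfE; apply/prodf_neq0 => a _.
  by rewrite mxE lt0r_neq0 ?Gpos.
by move=> /mxrank_unit <-; rewrite mulmx_max_rank.
Qed.

(** Orthogonality for the Hermitian form whose real part is G and whose
    imaginary part is, up to sign, the fundamental form. *)
Definition herm_orth u v := <<u, v>> = 0 /\ <<u, v *m J>> = 0.

Lemma herm_orth_sym u v : herm_orth u v -> herm_orth v u.
Proof.
move=> [uv uJv]; split; first by rewrite Gsym.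
by rewrite gprodJr Gsym uJv oppr0.
Qed.

Lemma mulJ_neq0 u : u != 0 -> u *m J != 0.
Proof.
apply: contra_neq => uJ0.
by apply: oppr_inj; rewrite -mulJJ uJ0 mul0mx oppr0.
Qed.

(** A Hermitian-orthogonal family is independent over the complex numbers:
    together with its image under J it is orthogonal for G. *)
Lemma herm_orth_card k (v : 'I_k -> V) : (forall a, v a != 0) ->
  (forall a b, a != b -> herm_orth (v a) (v b)) -> (k + k <= n)%N.
Proof.
move=> v0 vorth.
pose w (a : 'I_(k + k)) :=
  match fintype.split a with inl b => v b | inr b => v b *m J end.
apply: (@orthogonal_card _ w) => [a|a b].
  by rewrite /w; case: (fintype.split a) => b; rewrite ?mulJ_neq0.
rewrite -(splitK a) -(splitK b) /w !unsplitK.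
case: (fintype.split a) => {}a; case: (fintype.split b) => {}b ab.
- apply: (vorth _ _ _).1.
  by apply: contra_neq ab => ->.
- have [->|{}ab] := eqVneq a b; first exact: gprod_selfJ.
  by have [] := vorth _ _ ab.
- have [->|{}ab] := eqVneq a b; first by rewrite Gsym gprod_selfJ.
  have [_] := vorth _ _ ab; rewrite gprodJr => /eqP.
  by rewrite oppr_eq0 => /eqP.
- rewrite Jisom; apply: (vorth _ _ _).1.
  by apply: contra_neq ab => ->.
Qed.

(** Skew endomorphisms anticommuting with J. They are the alternating complex
    bilinear forms in disguise, which is why A u is orthogonal to the whole
    complex line of u. *)
Section Skew.
Context {A : V -> V}.
Hypothesis Askew : forall u v, <<A u, v>> = - <<u, A v>>.
Hypothesis Aanti : forall u, A (u *m J) = - (A u *m J).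

Lemma skew_herm_orth u : herm_orth (A u) u.
Proof.
split; first by have := Askew u u; rewrite (Gsym u); lra.
have := Askew u (u *m J); rewrite Aanti gprodNr.
by have := gprodJr (A u) u; rewrite (Gsym (A u *m J)); lra.
Qed.

Lemma skew_herm_orth_ker u v : A u = 0 -> herm_orth (A v) u.
Proof.
by move=> Au; split; rewrite Askew ?Aanti Au ?mul0mx ?oppr0 gprod0r oppr0.
Qed.

(** Such an endomorphism has even complex rank, and the complex dimension is at
    most 3, so it vanishes once it kills a complex plane. Concretely, if A w is
    nonzero then so is A (A w), and u, v, A w, A (A w) would be four nonzero
    vectors that are pairwise Hermitian-orthogonal. *)
Lemma skew_eq0 u v : (n < 8)%N -> u != 0 -> v != 0 -> herm_orth v u ->
  A u = 0 -> A v = 0 -> forall w, A w = 0.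
Proof.
move=> n8 u0 v0 vu Au Av w; apply/eqP/negP => /negP Aw0.
have [AAw0|AAw0] := eqVneq (A (A w)) 0.
  move/eqP: Aw0; apply; apply: gprod_eq0.
  by rewrite Askew AAw0 gprod0r oppr0.
pose s := [:: u; v; A w; A (A w)].
have ltorth (a b : 'I_4) : (a < b)%N -> herm_orth s`_b s`_a.
  case: a b => [[|[|[|[|//]]]] ?] [[|[|[|[|//]]]] ?] //= _;
    by [exact: skew_herm_orth_ker|exact: skew_herm_orth].
suff : (4 + 4 <= n)%N by rewrite leqNgt n8.
apply: (@herm_orth_card _ (fun a => s`_a)) => [|a b ab].
  by case=> [[|[|[|[|//]]]] ?] //=; apply/negP.
case: (ltngtP a b) => [/ltorth/herm_orth_sym//|/ltorth//|/val_inj e].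
by rewrite e eqxx in ab.
Qed.

End Skew.

(** Polarizing A (X + Y) (X + Y) = 0 asks for additivity in both arguments;
    additivity in the second one comes from skewness. *)
Lemma polarize_skew (A : V -> V -> V) :
  (forall X u v, <<A X u, v>> = - <<u, A X v>>) ->
  (forall X Y u, A (X + Y) u = A X u + A Y u) ->
  (forall X, A X X = 0) -> forall X Y, A X Y = - A Y X.
Proof.
move=> Askew AD AXX X Y; apply/eqP; rewrite -addr_eq0; apply/eqP.
apply: gprod_nondeg => v.
have := gprod0l G v; rewrite -(AXX (X + Y)) Askew AD gprodDl !gprodDr.
have := Askew X X v; have := Askew Y Y v; rewrite !AXX !gprod0l.
by rewrite gprodDl !Askew; lra.
Qed.

(** * The tangent space of a strict nearly Kaehler manifold *)

Section Pointwise.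
Context {A : V -> V -> V} {S : V -> V} {t : 'cV[R]_n}.
Hypothesis n8 : (n < 8)%N.
Hypothesis Askew : forall X u v, <<A X u, v>> = - <<u, A X v>>.
Hypothesis Aanti : forall X u, A X (u *m J) = - (A X u *m J).
Hypothesis Aalt : forall X Y, A X Y = - A Y X.
Hypothesis Astrict : forall X, X != 0 -> exists Y, A X Y != 0.
Hypothesis Sskew : forall u v, <<S u, v>> = - <<u, S v>>.
Hypothesis Santi : forall u, S (u *m J) = - (S u *m J).

(** Here A X is the covariant derivative of J along X, and S is the
    endomorphism given by the 2-form. The equation is the derivative along X of
    S J = - J S when the covariant derivative of the 2-form along X is the wedge
    product of X with t. *)
Hypothesis NA : forall X u v,
  wedge_covec G X t (u *m J) v + <<S (A X u), v>> =
  wedge_covec G X t u (v *m J) + <<S u, A X v>>.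

Lemma skew_self X : A X X = 0.
Proof.
have /eqP := Aalt X X; rewrite -subr_eq0 opprK -mulr2n -scaler_nat scaler_eq0.
by rewrite pnatr_eq0 => /eqP.
Qed.

(** The term of the equation that contains t cannot be balanced: on the diagonal
    X = u = v it is a multiple of the squared norm of u, whereas the terms
    containing S vanish because A u u = 0. *)
Lemma covector_part_eq0 : t = 0.
Proof.
have S0 : S 0 = 0.
  by apply: gprod_nondeg => v; rewrite Sskew gprod0l oppr0.
have tJ u : (u *m J *m t) 0 0 = 0.
  have [->|u0] := eqVneq u 0; first by rewrite !mul0mx mxE.
  have := NA u u u; rewrite /wedge_covec skew_self S0.
  rewrite gprod0l gprod0r gprod_selfJ => E.
  have := Gpos u0; move: (gprod G u u) (fun_of_matrix _ _ _) E => c d E c0.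
  by apply: (mulfI (lt0r_neq0 c0)); move: E; rewrite mulr0; lra.
apply/colP => i; have := tJ (- (basis_vec i *m J)).
rewrite !mulNmx mulJJ mulNmx opprK /basis_vec -rowE mxE => ->.
by rewrite mxE.
Qed.

(** With t = 0 the equation forces A u to kill S u. As A u also kills u, and S u
    is Hermitian-orthogonal to u, a nonzero S u would make A u vanish, against
    strictness. *)
Lemma antiinvariant_eq0 u : S u = 0.
Proof.
have [->|u0] := eqVneq u 0.
  by apply: gprod_nondeg => v; rewrite Sskew gprod0l oppr0.
have ASu : A u (S u) = 0.
  apply: gprod_nondeg => X; rewrite Askew Aalt gprodNr opprK.
  have := NA X u u; rewrite /wedge_covec covector_part_eq0.
  rewrite !mulmx0 mxE !mulr0 subrr !add0r.
  by rewrite Sskew (Gsym (A X u)); lra.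
apply/eqP/negP => /negP Su0; have [Y /eqP[]] := Astrict u0.
by apply: (skew_eq0 (Askew u) (Aanti u) n8 u0 Su0);
  [exact: (skew_herm_orth Sskew Santi)|exact: skew_self|].
Qed.

End Pointwise.
End Hermitian.

(** * Directional derivatives of matrix-valued functions *)

Section MatrixCalculus.
Context {R : realType} {V : normedModType R}.

(** The entries are enough, a matrix being the combination of the elementary
    matrices with its entries as coefficients. *)
Lemma differentiable_mx m p (F : V -> 'M[R]_(m, p)) x :
  (forall i j, differentiable (fun z => F z i j) x) -> differentiable F x.
Proof.
move=> dF.
have -> : F = \sum_i \sum_j (fun z => F z i j *: delta_mx i j).
  apply/funext => z; rewrite fct_sumE [LHS]matrix_sum_delta.
  by apply: eq_bigr => i _; rewrite fct_sumE.
apply: differentiable_sum => i; apply: differentiable_sum => j.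
exact: differentiableZl.
Qed.

Lemma derive_direction_lin (W : normedModType R) (f : V -> W) x (c : R) u v :
  differentiable f x -> 'D_(c *: u + v) f x = c *: 'D_u f x + 'D_v f x.
Proof. by move=> df; rewrite !deriveE// linearP. Qed.

Lemma derive_mulmx m p q (F : V -> 'M[R]_(m, p)) (G : V -> 'M[R]_(p, q)) x X :
  differentiable F x -> differentiable G x ->
  is_derive x X (fun z => F z *m G z) ('D_X F x *m G x + F x *m 'D_X G x).
Proof.
move=> /(@diff_derivable _ _ _ _ _ X) dF /(@diff_derivable _ _ _ _ _ X) dG.
have dFij := (derivable_mxP _ _ _).1 dF.
have dGij := (derivable_mxP _ _ _).1 dG.
have H i j : is_derive x X (fun z => (F z *m G z) i j)
    (('D_X F x *m G x + F x *m 'D_X G x) i j).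
  have -> : (fun z => (F z *m G z) i j) =
      \sum_k ((fun z => F z i k) * (fun z => G z k j)).
    by apply/funext => z; rewrite mxE fct_sumE.
  apply: is_derive_eq.
    by apply: is_derive_sum => k; apply: is_deriveM; apply: derivableP.
  rewrite !mxE -big_split; apply: eq_bigr => k _.
  by rewrite !derive_mx// !mxE /= addrC; congr (_ + _); rewrite [LHS]mulrC.
have dFG : derivable (fun z => F z *m G z) x X.
  by apply/derivable_mxP => i j; case: (H i j).
apply: DeriveDef => //; rewrite derive_mx//; apply/matrixP => i j.
by rewrite mxE; case: (H i j).
Qed.

Lemma derive_mulmxr m p q (F : V -> 'M[R]_(m, p)) (B : 'M[R]_(p, q)) x X :
  differentiable F x -> 'D_X (fun z => F z *m B) x = 'D_X F x *m B.
Proof.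
move=> dF; have dB : differentiable (fun _ : V => B) x.
  exact: differentiable_cst.
have [_ ->] := derive_mulmx X dF dB.
by rewrite derive_cst mulmx0 addr0.
Qed.

Lemma derive_mulmxl m p q (A : 'M[R]_(m, p)) (F : V -> 'M[R]_(p, q)) x X :
  differentiable F x -> 'D_X (fun z => A *m F z) x = A *m 'D_X F x.
Proof.
move=> dF; have dA : differentiable (fun _ : V => A) x.
  exact: differentiable_cst.
have [_ ->] := derive_mulmx X dA dF.
by rewrite derive_cst mul0mx add0r.
Qed.

Lemma derive_mxE m p (F : V -> 'M[R]_(m, p)) x X i j :
  differentiable F x -> 'D_X (fun z => F z i j) x = 'D_X F x i j.
Proof.
by move=> /(@diff_derivable _ _ _ _ _ X) dF; rewrite derive_mx// mxE.
Qed.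

Lemma differentiable_mulmx m p q
    (F : V -> 'M[R]_(m, p)) (G : V -> 'M[R]_(p, q)) x :
  differentiable F x -> differentiable G x ->
  differentiable (fun z => F z *m G z) x.
Proof.
move=> dF dG; apply: differentiable_mx => i j.
have -> : (fun z => (F z *m G z) i j) =
      \sum_k ((fun z => F z i k) * (fun z => G z k j)).
    by apply/funext => z; rewrite mxE fct_sumE.
apply: differentiable_sum => k; apply: differentiableM.
  exact: (differentiable_comp dF (differentiable_coord (F x) i k)).
exact: (differentiable_comp dG (differentiable_coord (G x) k j)).
Qed.

Lemma derive_gprod n (G : V -> 'M[R]_n) x X u v :
  differentiable G x ->
  'D_X (fun z => gprod (G z) u v) x = gprod ('D_X G x) u v.
Proof.
move=> dG; rewrite /gprod derive_mxE.
  by rewrite derive_mulmxr ?derive_mulmxl//; apply: differentiable_mulmx.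
by do !apply: differentiable_mulmx.
Qed.

(** Skew symmetry is taken in its diagonal form, so that only the constant zero
    function is differentiated. *)
Lemma derive_skew n (G : V -> 'M[R]_n) x X : differentiable G x ->
  (\near x, forall u, gprod (G x) u u = 0) ->
  forall u v, gprod ('D_X G x) u v = - gprod ('D_X G x) v u.
Proof.
move=> dG Galt; apply: alternating_skew => u; rewrite -derive_gprod//.
rewrite (@near_eq_derive _ _ _ _ (fun _ => 0)) ?derive_cst//.
by apply: filterS Galt => z.
Qed.

Lemma differentiable_gprod n (G : V -> 'M[R]_n) x :
  (forall u v, differentiable (fun z => gprod (G z) u v) x) ->
  differentiable G x.
Proof.
move=> dG; apply: differentiable_mx => i j.
by under eq_fun do rewrite -gprod_basis; exact: dG.
Qed.

End MatrixCalculus.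

(** * Forms of degree one and two as matrices *)

Section Forms.
Context {R : realType} {n : nat}.
Local Notation V := 'rV[R]_n.

Lemma linear_form_sum (f : V -> R) :
  (forall c u v, f (c *: u + v) = c * f u + f v) ->
  forall u, f u = \sum_k u 0 k * f (basis_vec k).
Proof.
move=> flin u; pose h : {linear V -> R^o} := HB.pack f
  (GRing.isLinear.Build R V R^o *:%R f flin).
rewrite {1}[u]row_sum_delta -[f]/(h : _ -> _) linear_sum.
by apply: eq_bigr => k _; rewrite linearZ.
Qed.

Lemma vcons0 p (X : V) (Y : 'I_p -> V) : vcons X Y ord0 = X.
Proof. by rewrite /vcons unlift_none. Qed.

Lemma vcons_max (X v : V) : vcons X (fun _ : 'I_1 => v) ord_max = v.
Proof.
by rewrite /vcons; case: unliftP => // /eqP.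
Qed.

Lemma vcons2 (Y : 'I_2 -> V) : Y = vcons (Y ord0) (fun _ => Y ord_max).
Proof.
apply/funext => a; have [->|a0] := eqVneq a ord0; first by rewrite vcons0.
suff -> : a = ord_max by rewrite vcons_max.
by apply/val_inj; case: a a0 => [[|[|]]].
Qed.

(** A 2-form at a point is recorded by its matrix in the coordinate basis, so
    that products with J and with the metric become matrix products. *)
Definition form_mx (w : ('I_2 -> V) -> R) : 'M[R]_n :=
  \matrix_(i, j) w (vcons (basis_vec i) (fun _ => basis_vec j)).

Lemma form_mxE w (Y : 'I_2 -> V) : is_multilinear w ->
  w Y = gprod (form_mx w) (Y ord0) (Y ord_max).
Proof.
move=> wlin; rewrite {1}[Y]vcons2; move: (Y ord0) (Y ord_max) => u v.
have wE Z : w Z = w (vcons (Z ord0) (fun _ => Z ord_max)) by rewrite -vcons2.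
have linl v' c a b : w (vcons (c *: a + b) (fun _ => v')) =
    c * w (vcons a (fun _ => v')) + w (vcons b (fun _ => v')).
  have := wlin (vcons a (fun _ => v')) ord0 c a b.
  rewrite (wE [eta _ with _ |-> c *: a + b]) (wE [eta _ with _ |-> a]).
  by rewrite (wE [eta _ with _ |-> b]) /= !vcons_max.
have linr u' c a b : w (vcons u' (fun _ => c *: a + b)) =
    c * w (vcons u' (fun _ => a)) + w (vcons u' (fun _ => b)).
  have := wlin (vcons u' (fun _ => a)) ord_max c a b.
  rewrite (wE [eta _ with _ |-> c *: a + b]) (wE [eta _ with _ |-> a]).
  by rewrite (wE [eta _ with _ |-> b]) /= !vcons0.
rewrite (@linear_form_sum (fun a => w (vcons a _)) (linl v)).
rewrite /gprod -mulmxA mxE; apply: eq_bigr => k _; congr (_ * _).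
rewrite (@linear_form_sum (fun a => w (vcons _ (fun _ => a))) (linr _)).
by rewrite mxE; apply: eq_bigr => l _; rewrite !mxE mulrC.
Qed.

Lemma form1_mxE (w : ('I_1 -> V) -> R) (Y : 'I_1 -> V) : is_multilinear w ->
  w Y = (Y ord0 *m \col_k w (fun _ => basis_vec k)) 0 0.
Proof.
move=> wlin; have wE Z : w Z = w (fun _ => Z ord0).
  by congr (w _); apply/funext => a; rewrite (ord1 a).
rewrite wE.
have lin c u v : w (fun _ => c *: u + v) = c * w (fun _ => u) + w (fun _ => v).
  have := wlin (fun _ => u) ord0 c u v.
  rewrite (wE [eta _ with _ |-> c *: u + v]) (wE [eta _ with _ |-> u]).
  by rewrite (wE [eta _ with _ |-> v]).
rewrite (@linear_form_sum (fun a => w (fun _ => a)) lin) mxE.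
by apply: eq_bigr => k _; rewrite mxE.
Qed.

Lemma form_mx_skew w u v : is_multilinear w -> is_alternating w ->
  gprod (form_mx w) u v = - gprod (form_mx w) v u.
Proof.
move=> wlin walt; move: u v; apply: alternating_skew => a.
have := form_mxE (vcons a (fun _ => a)) wlin.
rewrite vcons0 vcons_max => <-.
by apply: (walt _ ord0 ord_max) => //; rewrite vcons0 vcons_max.
Qed.

End Forms.

(** * The Levi-Civita connection at a point *)

(** The first derivatives of the metric at a point enter only through a linear
    family D of symmetric matrices, where D X stands for the derivative along X;
    the properties of the connection are consequences of this alone. *)
Section Koszul.
Context {R : realType} {n : nat} (G : 'M[R]_n) (D : 'rV[R]_n -> 'M[R]_n).
Local Notation V := 'rV[R]_n.
Implicit Types u v w X Y : V.

Definition koszul_of u v w : R :=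
  2^-1 * (gprod (D u) v w + gprod (D v) u w - gprod (D w) u v).

Definition christoffel_of u v : V :=
  (\row_k koszul_of u v (basis_vec k)) *m invmx G.

Hypothesis Gunit : G \in unitmx.
Hypothesis Gsym : forall u v, gprod G u v = gprod G v u.
Hypothesis Dsym : forall X u v, gprod (D X) u v = gprod (D X) v u.
Hypothesis Dlin : forall c X Y, D (c *: X + Y) = c *: D X + D Y.

Lemma gprod_christoffel u v w :
  gprod G (christoffel_of u v) w = koszul_of u v w.
Proof.
rewrite gprod_invmx// (@linear_form_sum _ _ (koszul_of u v)).
  by apply: eq_bigr => k _; rewrite mxE.
by move=> c a b; rewrite /koszul_of Dlin gprod_linm !gprodDr !gprodZr; ring.
Qed.

Lemma christoffel_sym u v : christoffel_of u v = christoffel_of v u.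
Proof.
congr (_ *m _); apply/rowP => k; rewrite !mxE /koszul_of (Dsym _ u v).
by rewrite (addrC (gprod (D u) _ _)).
Qed.

Lemma christoffel_lin c u v w : christoffel_of (c *: u + v) w =
  c *: christoffel_of u w + christoffel_of v w.
Proof.
rewrite /christoffel_of scalemxAl -mulmxDl; congr (_ *m _); apply/rowP => k.
by rewrite !mxE /koszul_of Dlin gprod_linm !gprodDl !gprodZl; ring.
Qed.

Lemma christoffelN u v : christoffel_of u (- v) = - christoffel_of u v.
Proof.
have lin0 : christoffel_of 0 u = 0.
  have /eqP := christoffel_lin 1 0 0 u; rewrite !scale1r addr0.
  by rewrite -subr_eq0 opprD addNKr oppr_eq0 => /eqP.
have := christoffel_lin (-1) v 0 u.
by rewrite !scaleN1r lin0 !addr0 !(christoffel_sym _ u).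
Qed.

(** In the sum of the Koszul formulas for (X, u, v) and (X, v, u) the derivatives
    along u and along v cancel. *)
Lemma metric_compatible X u v : gprod (D X) u v =
  gprod G (christoffel_of X u) v + gprod G u (christoffel_of X v).
Proof.
rewrite (Gsym u) !gprod_christoffel /koszul_of.
by rewrite (Dsym X v u); lra.
Qed.

End Koszul.

(** * Covariant derivatives at a point *)

(** The direction of differentiation is fixed: Gam is the connection in this
    direction, and primes denote the ordinary derivatives of the matrices. *)
Section Covariant.
Context {R : realType} {n : nat}.
Local Notation V := 'rV[R]_n.
Context (J J' : 'M[R]_n) (Gam : V -> V).
Implicit Types u v : V.

Definition cov_form (F F' : 'M[R]_n) u v : R :=
  gprod F' u v - gprod F (Gam u) v - gprod F u (Gam v).

Definition cov_endo u : V := u *m J' + Gam (u *m J) - Gam u *m J.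

(** The Leibniz rule for the fundamental form, whose matrix is J G: as the metric
    is parallel, only the derivative of J remains. *)
Lemma cov_form_mulmx (G G' : 'M[R]_n) u v :
  (forall u v, gprod G' u v = gprod G (Gam u) v + gprod G u (Gam v)) ->
  cov_form (J *m G) (J' *m G + J *m G') u v = gprod G (cov_endo u) v.
Proof.
move=> compat; rewrite /cov_form /cov_endo !gprodDl gprodNl.
rewrite gprodDm -!gprodA compat; lra.
Qed.

(** The derivative of J J = - 1. *)
Lemma cov_endo_anti u : J *m J = - 1%:M -> J' *m J + J *m J' = 0 ->
  Gam (- u) = - Gam u -> cov_endo (u *m J) = - (cov_endo u *m J).
Proof.
move=> JJ dJJ GamN; rewrite /cov_endo mulmxBl mulmxDl !(mulJJ JJ) GamN.
have -> : u *m J *m J' = - (u *m J' *m J).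
  by apply/eqP; rewrite -subr_eq0 opprK addrC -!mulmxA -mulmxDr dJJ mulmx0.
by rewrite opprK !opprD [LHS]addrAC.
Qed.

(** The derivative of F (u J, v) = F (u, v J): the terms of cov_form in which Gam
    is applied to the vector without J cancel those of cov_endo in which J comes
    after Gam, by the undifferentiated identity. *)
Lemma cov_form_anti (F F' : 'M[R]_n) u v :
  J *m F = F *m J^T -> J' *m F + J *m F' = F' *m J^T + F *m J'^T ->
  cov_form F F' (u *m J) v + gprod F (cov_endo u) v =
  cov_form F F' u (v *m J) + gprod F u (cov_endo v).
Proof.
move=> JF dJF.
have FJ a b : gprod F (a *m J) b = gprod F a (b *m J).
  by rewrite gprodA gprodAr JF.
have dFJ : gprod F (u *m J') v + gprod F' (u *m J) v =
           gprod F' u (v *m J) + gprod F u (v *m J').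
  rewrite !gprodA !gprodAr.
  by rewrite -!gprodDm dJF.
rewrite /cov_form /cov_endo !gprodDl !gprodDr !gprodNl !gprodNr !FJ.
by move: dFJ; rewrite -!FJ; lra.
Qed.
End Covariant.

Section NablaForm.
Context {R : realType} {n : nat} (g : 'rV[R]_n -> 'M[R]_n) (x : 'rV[R]_n).
Local Notation V := 'rV[R]_n.
Hypothesis gdiff : differentiable g x.

Lemma christoffelE u v :
  christoffel g x u v = christoffel_of (g x) (fun X => 'D_X g x) u v.
Proof.
congr (_ *m _); apply/rowP => k; rewrite !mxE /koszul !derive_gprod//.
Qed.

Lemma nabla_formE (w : local_form 2) (F : V -> 'M[R]_n) X (Y : 'I_2 -> V) :
  differentiable F x ->
  (\near x, forall Y, w x Y = gprod (F x) (Y ord0) (Y ord_max)) ->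
  nabla_form g X w x Y =
  cov_form (christoffel g x X) (F x) ('D_X F x) (Y ord0) (Y ord_max).
Proof.
move=> dF wF; have wFx := nbhs_singleton wF.
rewrite /nabla_form /cov_form big_ord_recl big_ord1 !wFx /= opprD addrA.
rewrite (_ : lift ord0 ord0 = ord_max); last exact: val_inj.
congr (_ - _ - _); rewrite -derive_gprod//; apply: near_eq_derive.
by apply: filterS wF => z.
Qed.

End NablaForm.

(** * Almost Hermitian structures in a chart *)

Section Chart.
Context {R : realType} {n : nat} (M : manifold R n) (i : chart_index M).
Context (x : 'rV[R]_n).
Local Notation V := 'rV[R]_n.
Hypothesis Ux : img i x.

Lemma near_img (P : V -> Prop) : (forall z, img i z -> P z) -> \near x, P x.
Proof.
move=> imgP; apply: filterS imgP _.
by apply: open_nbhs_nbhs; split => //; exact: chart_img_open.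
Qed.

Lemma smooth_differentiable (W : normedModType R) (f : V -> W) :
  smooth_on (img i) f -> differentiable f x.
Proof. by move=> /(_ [::] x Ux). Qed.

Lemma metric_differentiable (g : riem_metric M) : differentiable (g i) x.
Proof.
apply: differentiable_gprod => u v.
exact: (smooth_differentiable (@riem_smooth _ _ _ g i u v)).
Qed.

Lemma acs_differentiable (J : almost_complex M) : differentiable (J i) x.
Proof.
apply: differentiable_mx => a b.
have -> : (fun z => J i z a b) =
    (fun v : V => v 0 b) \o (fun z => basis_vec a *m J i z).
  by apply/funext => z /=; rewrite /basis_vec -rowE mxE.
apply: differentiable_comp; last exact: differentiable_coord.
exact: (smooth_differentiable (@acs_smooth _ _ _ J i _)).
Qed.

Lemma form_mx_differentiable (w : pform M 2) :
  differentiable (fun z => form_mx (w i z)) x.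
Proof.
apply: differentiable_mx => a b; under eq_fun do rewrite mxE.
by case: (pform_smooth w i) => _ _ /(_ _)/smooth_differentiable.
Qed.

Context (g : riem_metric M) (J : almost_complex M).
Local Notation gam := (christoffel (g i) x).
Local Notation dJ := (fun X => 'D_X (J i) x).

Lemma riem_unit : g i x \in unitmx.
Proof. by apply: metric_unit => u; exact: riem_pos. Qed.

Lemma metric_derive_sym X u v :
  gprod ('D_X (g i) x) u v = gprod ('D_X (g i) x) v u.
Proof.
rewrite -!derive_gprod; [|exact: metric_differentiable..].
by apply: near_eq_derive; apply: near_img => z Uz; exact: riem_sym.
Qed.

Let dg_lin c X Y :
  'D_(c *: X + Y) (g i) x = c *: 'D_X (g i) x + 'D_Y (g i) x.
Proof. exact: (derive_direction_lin _ _ _ (metric_differentiable g)). Qed.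

Lemma levi_civita_metric X u v : gprod ('D_X (g i) x) u v =
  gprod (g i x) (gam X u) v + gprod (g i x) u (gam X v).
Proof.
rewrite !christoffelE; [|exact: metric_differentiable..].
apply: (metric_compatible riem_unit _ metric_derive_sym dg_lin) => a b.
exact: riem_sym.
Qed.

Lemma levi_civita_lin c X Y u : gam (c *: X + Y) u = c *: gam X u + gam Y u.
Proof.
rewrite !christoffelE; [|exact: metric_differentiable..].
exact: (christoffel_lin _ dg_lin).
Qed.

Lemma levi_civitaN X u : gam X (- u) = - gam X u.
Proof.
rewrite !christoffelE; [|exact: metric_differentiable..].
exact: (christoffelN _ metric_derive_sym dg_lin).
Qed.

Lemma acs_derive_anti X : dJ X *m J i x + J i x *m dJ X = 0.
Proof.
have dJ := acs_differentiable J.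
have [_ <-] := derive_mulmx X dJ dJ.
rewrite (@near_eq_derive _ _ _ _ (fun _ => - 1%:M)) ?derive_cst//.
by apply: near_img => z Uz; exact: acs_sqr.
Qed.

Local Notation A := (fun X => cov_endo (J i x) (dJ X) (gam X)).

Lemma nabla_endoE X u : nabla_endo (g i) (J i) X x u = A X u.
Proof.
by rewrite /nabla_endo derive_mulmxl//; exact: acs_differentiable.
Qed.

Lemma nabla_endo_lin c X Y u : A (c *: X + Y) u = c *: A X u + A Y u.
Proof.
rewrite /cov_endo !levi_civita_lin.
rewrite (derive_direction_lin _ _ _ (acs_differentiable J)).
rewrite mulmxDr mulmxDl -scalemxAr -scalemxAl !scalerDr scalerN opprD.
by rewrite [X in X + _ = _]addrACA [LHS]addrACA.
Qed.

Lemma nabla_fundamental X u v :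
  nabla_form (g i) X (fundamental_form g J i) x (vcons u (fun _ => v)) =
  gprod (g i x) (A X u) v.
Proof.
have dg := metric_differentiable g; have dJ := acs_differentiable J.
rewrite (@nabla_formE _ _ _ _ _ (fun z => J i z *m g i z)).
- have [_ ->] := derive_mulmx X dJ dg.
  rewrite vcons0 vcons_max; apply: cov_form_mulmx => a b.
  exact: levi_civita_metric.
- exact: differentiable_mulmx.
- by apply: near_img => z _ Y; rewrite -gprodA.
Qed.

Hypothesis gJ : almost_hermitian g J.

(** The fundamental form is alternating near x, hence so is its covariant
    derivative. *)
Lemma nabla_endo_skew X u v :
  gprod (g i x) (A X u) v = - gprod (g i x) u (A X v).
Proof.
rewrite (riem_sym g u)// -!nabla_fundamental.
have dg := metric_differentiable g; have dJ := acs_differentiable J.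
have dW := differentiable_mulmx dJ dg.
have WE : \near x, forall Y, fundamental_form g J i x Y =
    gprod (J i x *m g i x) (Y ord0) (Y ord_max).
  by apply: near_img => z _ Y; rewrite -gprodA.
have Walt z a : img i z -> gprod (J i z *m g i z) a a = 0.
  move=> Uz; rewrite -gprodA (riem_sym g)//.
  exact: (gprod_selfJ (fun u v => riem_sym g u v Uz) (acs_sqr J Uz)
    (fun u v => gJ u v Uz)).
have Wskew := alternating_skew (fun a => Walt x a Ux).
have dWskew := derive_skew X dW (near_img (fun z Uz a => Walt z a Uz)).
rewrite !(nabla_formE _ _ _ dW WE) !vcons0 !vcons_max /cov_form.
by rewrite (dWskew u) (Wskew u) (Wskew (gam X u)); lra.
Qed.

End Chart.

(** * Anti-invariant closed conformal Killing 2-forms *)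

Section AntiInvariant.
Context {R : realType} {n : nat} (M : manifold R n) (i : chart_index M).
Context (x : 'rV[R]_n).
Hypothesis Ux : img i x.
Context (g : riem_metric M) (J : almost_complex M).
Local Notation gam := (christoffel (g i) x).
Local Notation A := (fun X => cov_endo (J i x) ('D_X (J i) x) (gam X)).
Local Notation V := 'rV[R]_n.

(** The nearly Kaehler condition says that the derivative of J along Z kills Z;
    this is its polarization. *)
Lemma nearly_kahler_alt X Y : almost_hermitian g J -> nearly_kahler g J ->
  A X Y = - A Y X.
Proof.
move=> gJ nk; have AXX Z : A Z Z = 0.
  apply: (gprod_nondeg (G := g i x)) => [u u0|v]; first exact: riem_pos.
  have := nk i x Z (fun _ => v) Ux.
  by rewrite /interior_product nabla_fundamental.
have AD Z W v : A (Z + W) v = A Z v + A W v.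
  by have := nabla_endo_lin Ux g J 1 Z W v; rewrite !scale1r.
apply: (polarize_skew (G := g i x) _ (A := A)) => // [u u0|Z].
  exact: riem_pos.
exact: nabla_endo_skew.
Qed.

(** Replacing v by v J removes one of the two factors J from the definition of
    anti-invariance, which leaves an identity that is simpler to differentiate. *)
Lemma anti_invariant_form_mx (sigma : pform M 2) :
  anti_invariant J sigma -> forall z, img i z ->
  J i z *m form_mx (sigma i z) = form_mx (sigma i z) *m (J i z)^T.
Proof.
move=> anti z Uz; apply: gprod_inj => u v; rewrite -gprodA -gprodAr.
have [lin _ _] := pform_smooth sigma i.
have sE := fun Y => form_mxE Y (lin z Uz).
have := anti i z (vcons u (fun _ => v *m J i z)) Uz.
rewrite !sE !vcons0 !vcons_max (mulJJ (acs_sqr J Uz)) gprodNr.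
by move/oppr_inj.
Qed.

Lemma cov_anti_invariant (sigma : pform M 2) X u v :
  anti_invariant J sigma ->
  let F z := form_mx (sigma i z) in
  let N := cov_form (gam X) (F x) ('D_X F x) in
  N (u *m J i x) v + gprod (F x) (A X u) v =
  N u (v *m J i x) + gprod (F x) u (A X v).
Proof.
move=> anti F N; have antiJ := anti_invariant_form_mx anti.
apply: cov_form_anti; first exact: antiJ.
have dJ := acs_differentiable Ux J; have dF := form_mx_differentiable Ux sigma.
have dJT : differentiable (fun z => (J i z)^T) x.
  apply: differentiable_mx => a b; under eq_fun do rewrite mxE.
  exact: (differentiable_comp dJ (differentiable_coord (J i x) b a)).
have [_ <-] := derive_mulmx X dJ dF.
have <- : 'D_X (fun z => (J i z)^T) x = ('D_X (J i) x)^T.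
  apply/matrixP => a b; rewrite mxE -!derive_mxE//.
  by congr ('D_X _ x); apply/funext => z; rewrite mxE.
have [_ <-] := derive_mulmx X dF dJT.
by apply: near_eq_derive; apply: (near_img Ux) => z Uz; exact: antiJ.
Qed.

(** Closedness removes the first term of the conformal Killing equation, and the
    codifferential tau provides the covector up to a constant factor. *)
Lemma star_killing_cov (sigma : pform M 2) : star_killing g sigma ->
  exists t : 'cV[R]_n, forall X u v,
    cov_form (gam X) (form_mx (sigma i x))
      ('D_X (fun z => form_mx (sigma i z)) x) u v =
    wedge_covec (g i x) X t u v.
Proof.
move=> [[tau _ ck] clo]; pose c := (n%:R - 2%:R + 1 : R)^-1.
have [taulin _ _] := pform_smooth tau i.
have [siglin _ _] := pform_smooth sigma i.
exists (- c *: \col_k tau i x (fun _ => basis_vec k)) => X u v.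
have := ck i x X (vcons u (fun _ => v)) Ux.
rewrite /interior_product clo// mulr0 sub0r.
rewrite (@nabla_formE _ _ _ _ _ (fun z => form_mx (sigma i z))); last 2 first.
- exact: form_mx_differentiable.
- by apply: (near_img Ux) => z Uz Y; exact: form_mxE (siglin z Uz).
rewrite /wedge_vec big_ord_recl big_ord1.
rewrite !(form1_mxE _ (taulin x Ux)).
rewrite /comp (_ : lift ord0 ord0 = ord_max); last exact: val_inj.
rewrite (_ : lift ord_max ord0 = ord0); last exact: val_inj.
rewrite !vcons0 !vcons_max expr0 expr1 => ->.
have scaleE (a : V) T : (a *m (- c *: T)) 0 0 = - c * (a *m T) 0 0.
  by rewrite -scalemxAr mxE.
by rewrite /wedge_covec !scaleE /c; ring.
Qed.

End AntiInvariant.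

Theorem proposition5p2 (R : realType) (M : manifold R 6)
    (g : riem_metric M) (J : almost_complex M)
    (compactM : compact [set: M])
    (nkM : strict_nearly_kahler g J) :
  ~ exists sigma : pform M 2,
      [/\ anti_invariant J sigma, star_killing g sigma
        & nontrivial_form sigma].
Proof.
move=> [sigma [anti sk [i [x [Y [Ux]]]]]].
have [gJ nk strict] := nkM.
have [lin alt _] := pform_smooth sigma i.
have [t tE] := star_killing_cov Ux sk.
have Gunit := riem_unit Ux g.
have FJ := anti_invariant_form_mx anti Ux.
pose S (u : 'rV[R]_6) := u *m form_mx (sigma i x) *m invmx (g i x).
have SE u v : gprod (g i x) (S u) v = gprod (form_mx (sigma i x)) u v.
  by rewrite /gprod mulmxKV.
have Gpos u : u != 0 -> 0 < gprod (g i x) u u by exact: riem_pos.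
have Gsym u v : gprod (g i x) u v = gprod (g i x) v u by exact: riem_sym.
have skew := form_mx_skew _ _ (lin x Ux) (alt x Ux).
have Sskew u v : gprod (g i x) (S u) v = - gprod (g i x) u (S v).
  by rewrite (Gsym u) !SE skew.
have Santi u : S (u *m J i x) = - (S u *m J i x).
  apply/eqP; rewrite -addr_eq0; apply/eqP; apply: (gprod_nondeg Gpos) => v.
  rewrite gprodDl SE gprodA FJ -gprodAr -SE.
  by rewrite (gprodJr (acs_sqr J Ux) (fun u v => gJ i x u v Ux)) addNr.
rewrite (form_mxE _ (lin x Ux)) -SE.
rewrite (antiinvariant_eq0 Gsym Gpos (acs_sqr J Ux) (fun u v => gJ i x u v Ux)
  (A := fun X => cov_endo (J i x) ('D_X (J i) x) (christoffel (g i) x X))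
  (t := t) _ _ _ _ _ Sskew Santi) ?gprod0l //.
- exact: nabla_endo_skew.
- move=> X u; apply: cov_endo_anti; [exact: acs_sqr|exact: acs_derive_anti|].
  exact: levi_civitaN.
- by move=> X Z; apply: nearly_kahler_alt.
- move=> X /(strict i x X Ux)[Z]; rewrite nabla_endoE// => AXZ; by exists Z.
- by move=> X u v; rewrite -!tE !SE; exact: cov_anti_invariant.
Qed.
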